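(* Let $I=(U,R)$ be an approximation space and let $(T,\Delta,\nabla)$ be its rough semiring. For $RS(Y),RS(Z)\in T$, the relative pseudocomplement of $RS(Y)$ with respect to $RS(Z)$ is unique.
   Context: Setting. $I=(U,R)$ is an approximation space: $U$ is a non-empty finite set, $R$ an arbitrary equivalence relation on $U$, and $[x]_R$ is the class of $x$. For $X\subseteq U$ put $R_{-}(X)=\{x\in U: [x]_R\subseteq X\}$, $R^{-}(X)=\{x\in U: [x]_R\cap X\neq\emptyset\}$. The rough set of $X$ is $RS(X)=(R_{-}(X),R^{-}(X))$, and $T=\{RS(X): X\subseteq U\}$. $T$ is ordered componentwise: $RS(X)\le RS(Y)$ iff $R_{-}(X)\subseteq R_{-}(Y)$ and $R^{-}(X)\subseteq R^{-}(Y)$. Operations on subsets of $U$. Let $IW(X)$ be the number of equivalence classes contained in $X$. Praba join: if $IW(X\cup Y)=IW(X)+IW(Y)-IW(X\cap Y)$ then $X\Delta Y=X\cup Y$. If $IW(X\cup Y)>IW(X)+IW(Y)-IW(X\cap Y)$, one identifies an equivalence class newly formed by the union (contained in $X\cup Y$ but in neither $X$ nor $Y$), deletes from $Y$ its elements belonging to that class, calls the result $Y$ again, and repeats until equality holds; then $X\Delta Y$ is the union of $X$ and the final $Y$. Praba meet: $x$ is a pivot element of $X,Y$ if $[x]_R\not\subseteq X\cap Y$, $[x]_R\cap X\ne\emptyset$ and $[x]_R\cap Y\neq\emptyset$; the pivot set $P_{X\cap Y}$ is the set of pivot elements, each pivot element in it being taken as the representative of its class; $X\nabla Y=\{x\in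 U:[x]_R\subseteq X\cap Y\}\cup P_{X\cap Y}$. Operations on $T$. $RS(X)\Delta RS(Y)=RS(X\Delta Y)$ and $RS(X)\nabla RS(Y)=RS(X\nabla Y)$; it is known that these are respectively the least upper bound and the greatest lower bound of $RS(X),RS(Y)$ in $T$, and that $(T,\Delta,\nabla)$ is a semiring, called the rough semiring. Definition. For $RS(Y),RS(Z)\in T$, an element $RS(Y)\rightarrow RS(Z)$ of $T$ is the relative pseudocomplement of $RS(Y)$ with respect to $RS(Z)$ if it is the greatest element $\max\{RS(W)\in T: RS(Y)\nabla RS(W)\le RS(Z)\}$. *)

(* Defs.v *)
From HB Require Import structures.
From mathcomp Require Import all_boot all_order all_algebra.

Set Implicit Arguments.
Unset Strict Implicit.
Unset Printing Implicit Defensive.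

Record approxSpace := ApproxSpace {
  universe :> finType;
  indisc : rel universe;
  universe_gt0 : 0 < #|universe|;
  indisc_equiv : equivalence_rel indisc
}.

Section SubsetOperations.
Variable I : approxSpace.
Implicit Types (x y : I) (X Y C P : {set I}).

Definition eclass x : {set I} := [set y | indisc x y].
Definition eclasses : {set {set I}} := equivalence_partition (@indisc I) setT.

Definition lower X : {set I} := [set x | eclass x \subset X].
Definition upper X : {set I} := [set x | eclass x :&: X != set0].
Definition RS X : {set I} * {set I} := (lower X, upper X).

Definition IW X : nat := #|[set C in eclasses | C \subset X]|.

(* Praba join.  The class removed at each step is an arbitrary one (chosen by
   [pick]); every step decreases the number of newly formed classes, hence
   #|I| steps always reach the equality case, where [join_step] stops. *)
Definition new_classes X Y : {set {set I}} :=
  [set C in eclasses |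
    [&& C \subset X :|: Y, ~~ (C \subset X) & ~~ (C \subset Y)]].
Definition join_step X Y : {set I} :=
  if IW X + IW Y - IW (X :&: Y) < IW (X :|: Y) then
    if [pick C in new_classes X Y] is Some C then Y :\: C else Y
  else Y.
Definition praba_join X Y : {set I} := X :|: iter #|I| (join_step X) Y.

(* Praba meet.  The pivot set contains exactly one representative of each
   class made of pivot elements: taking all the pivot elements instead would
   put whole classes into the meet.  [RS_meet_transversal] below shows that
   the choice of the representatives does not affect the rough set. *)
Definition pivots X Y : {set I} :=
  [set x | [&& ~~ (eclass x \subset X :&: Y),
               eclass x :&: X != set0 & eclass x :&: Y != set0]].
Definition pivot_set X Y : {set I} :=
  transversal (equivalence_partition (@indisc I) (pivots X Y)) (pivots X Y).
Definition praba_meet X Y : {set I} :=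
  [set x | eclass x \subset X :&: Y] :|: pivot_set X Y.

Lemma eclass_refl x : x \in eclass x.
Proof. by rewrite inE; case: (indisc_equiv x x x). Qed.

Lemma eclass_eq x y : y \in eclass x -> eclass y = eclass x.
Proof.
rewrite inE => xy; apply/setP=> z; rewrite !inE.
by have [_ /(_ xy) ->] := indisc_equiv x y z.
Qed.

Lemma eclassesP C : reflect (exists x, C = eclass x) (C \in eclasses).
Proof.
apply: (iffP imsetP) => [[x _ ->]|[x ->]]; exists x => //;
  by apply/setP=> y; rewrite !inE.
Qed.

Lemma lowerP x X : reflect {subset eclass x <= X} (x \in lower X).
Proof. by rewrite inE; apply: subsetP. Qed.

Lemma upperP x X :
  reflect (exists2 y, y \in eclass x & y \in X) (x \in upper X).
Proof.
rewrite inE; apply: (iffP (set0Pn _)) => [[y /setIP[]]|[y xy Xy]].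
  by exists y.
by exists y; rewrite inE xy.
Qed.

Lemma upperU X Y : upper (X :|: Y) = upper X :|: upper Y.
Proof.
apply/setP=> x; rewrite [RHS]inE; apply/upperP/orP.
  by case=> y xy /setUP[]; [left|right]; apply/upperP; exists y.
by case=> /upperP[y xy Xy]; exists y => //; rewrite inE Xy ?orbT.
Qed.

Lemma IW_join X Y :
  IW (X :|: Y) = IW X + IW Y - IW (X :&: Y) + #|new_classes X Y|.
Proof.
set A := [set C in eclasses | C \subset X].
set B := [set C in eclasses | C \subset Y].
have -> : IW (X :&: Y) = #|A :&: B|.
  by apply: eq_card => C; rewrite !inE subsetI; case: (C \in eclasses).
rewrite -[IW X + _ - _]/(#|A| + #|B| - #|A :&: B|) -cardsU.
have AN0 : (A :|: B) :&: new_classes X Y = set0.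
  apply/setP=> C; rewrite !inE; case: (C \in eclasses) => //=.
  by case: (C \subset X); case: (C \subset Y); rewrite ?andbF.
rewrite -[RHS]subn0 -(cards0 {set I}) -AN0 -cardsU.
apply: eq_card => C; rewrite !inE.
case: (C \in eclasses) => //=.
case CX: (C \subset X) => /=; first by rewrite (subset_trans CX) ?subsetUl.
case CY: (C \subset Y) => /=; first by rewrite (subset_trans CY) ?subsetUr.
by rewrite andbT.
Qed.

Lemma join_step_new X Y C :
    C \in new_classes X Y ->
  [/\ lower (Y :\: C) = lower Y, upper (X :|: Y :\: C) = upper (X :|: Y)
    & new_classes X (Y :\: C) \proper new_classes X Y].
Proof.
move=> newC; have:= newC; rewrite inE => /and4P[/eclassesP[c defC] sCXY nCX nCY].
have lowD : lower (Y :\: C) = lower Y.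
  apply/setP=> x; apply/lowerP/lowerP => sx y xy.
    by have:= sx y xy; rewrite inE => /andP[].
  rewrite inE sx // andbT; apply: contra nCY => yC.
  rewrite defC in yC *; rewrite -(eclass_eq yC) (eclass_eq xy).
  exact/subsetP.
have subD : X :|: Y :\: C \subset X :|: Y by rewrite setUS ?subsetDl.
split=> //.
  apply/setP=> x; apply/upperP/upperP => [[y xy XYy]|[y xy]].
    by exists y => //; apply: (subsetP subD).
  have [yC|nyC] := boolP (y \in C); last first.
    by rewrite !inE => XYy; exists y => //; rewrite !inE nyC.
  move=> _; have defCx : C = eclass x.
    by rewrite -(eclass_eq xy) defC; rewrite defC in yC; rewrite (eclass_eq yC).
  have /subsetPn[z zC nYz] := nCY; exists z; first by rewrite -defCx.
  by have:= subsetP sCXY z zC; rewrite !inE (negbTE nYz) orbF => ->.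
rewrite properE; apply/andP; split.
  apply/subsetP=> D; rewrite !inE => /and4P[DE sD nDX nDY].
  rewrite DE nDX (subset_trans sD subD) /=; apply: contra nDY => DY.
  have /eclassesP[d defD] := DE.
  have: d \in lower Y by rewrite inE -defD.
  by rewrite -lowD inE -defD.
apply/subsetPn; exists C => //; rewrite inE.
apply/negP=> /and4P[_ /subsetP sC _ _]; have /subsetPn[z zC nXz] := nCX.
by have:= sC z zC; rewrite !inE (negbTE nXz) zC.
Qed.

Lemma join_stepP X Y :
  [/\ lower (join_step X Y) = lower Y,
      upper (X :|: join_step X Y) = upper (X :|: Y)
    & #|new_classes X (join_step X Y)| <= #|new_classes X Y|.-1].
Proof.
rewrite /join_step; have:= IW_join X Y.
case: pickP => [C newC|noC] IWE.
  have [lowC upC /proper_card prC] := join_step_new newC.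
  have new_gt0 := leq_ltn_trans (leq0n _) prC.
  rewrite IWE -[X in X < _]addn0 ltn_add2l new_gt0.
  by split=> //; rewrite -ltnS prednK.
by rewrite if_same; split=> //; rewrite (eq_card0 noC).
Qed.

Lemma RS_join X Y :
  RS (praba_join X Y) = (lower X :|: lower Y, upper X :|: upper Y).
Proof.
have iterP n : [/\ lower (iter n (join_step X) Y) = lower Y,
    upper (X :|: iter n (join_step X) Y) = upper (X :|: Y)
  & #|new_classes X (iter n (join_step X) Y)| <= #|new_classes X Y| - n].
  elim: n => [|n [lowY upY newY]]; first by rewrite subn0.
  have [lowY' upY' newY'] := join_stepP X (iter n (join_step X) Y).
  rewrite iterS lowY' upY'; split=> //; apply: leq_trans newY' _.
  by rewrite subnS -!subn1 leq_sub2r.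
have [lowY upY newY] := iterP #|I|; rewrite /RS /praba_join upY upperU.
congr (_, _); rewrite -lowY; set Y' := iter _ _ _ in newY *.
have new0 : new_classes X Y' = set0.
  apply/eqP; rewrite -cards_eq0 -leqn0 (leq_trans newY) // leqn0 subn_eq0.
  apply: (@leq_trans #|eclasses|); last first.
    exact: leq_trans (leq_imset_card _ _) (max_card _).
  by apply/subset_leq_card/subsetP=> C; rewrite inE => /andP[].
apply/setP=> x; rewrite !inE; apply/idP/orP => [sx|]; last first.
  by case=> /subset_trans; apply; rewrite ?subsetUl ?subsetUr.
have:= in_set0 (eclass x); rewrite -new0 inE sx => /negbT.
have -> : eclass x \in eclasses by apply/eclassesP; exists x.
by rewrite /= negb_and !negbK => /orP.
Qed.

Lemma pivots_equiv X Y :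
  {in pivots X Y & &, equivalence_rel (@indisc I)}.
Proof. by move=> x y z _ _ _; apply: indisc_equiv. Qed.

Lemma RS_meet_transversal X Y P :
    is_transversal P (equivalence_partition (@indisc I) (pivots X Y))
      (pivots X Y) ->
  RS ([set x | eclass x \subset X :&: Y] :|: P) =
    (lower X :&: lower Y, upper X :&: upper Y).
Proof.
move=> trP; have sPp := transversal_sub trP.
have /and3P[_ _ /forall_inP trP1] := trP.
have pivE x y : y \in eclass x -> (y \in pivots X Y) = (x \in pivots X Y).
  by move=> xy; rewrite !inE (eclass_eq xy).
have P1 x : x \in pivots X Y -> exists y, P :&: eclass x = [set y].
  move=> px; apply/cards1P/trP1.
  apply/imsetP; exists x => //; apply/setP=> y; rewrite [RHS]inE.
  have [xy|nxy] := boolP (y \in eclass x).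
    by rewrite (pivE _ _ xy) px; rewrite inE in xy.
  by rewrite inE in nxy; rewrite (negbTE nxy) andbF.
have lowI x : (x \in lower X :&: lower Y) = (eclass x \subset X :&: Y).
  by rewrite !inE subsetI.
congr (_, _); apply/setP=> x.
  rewrite lowI; apply/lowerP/idP => [sx|sx y xy]; last first.
    by rewrite !inE (eclass_eq xy) sx.
  apply/negPn/negP=> nsx.
  have sxP y : y \in eclass x -> y \in P.
    by move=> xy; have:= sx y xy; rewrite !inE (eclass_eq xy) (negbTE nsx).
  have px : x \in pivots X Y by apply: (subsetP sPp); apply/sxP/eclass_refl.
  have [y Py] := P1 x px; have Ey : eclass x = [set y].
    by rewrite -Py; apply/esym/setIidPr/subsetP.
  have:= px; rewrite inE (negbTE nsx) Ey.
  case/and3P=> _ /set0Pn[z1 /setIP[/set1P-> Xy]] /set0Pn[z2 /setIP[/set1P-> Yy]].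
  by case/negP: nsx; rewrite Ey sub1set inE Xy.
apply/upperP/setIP => [[y xy]|[/[dup] ux /upperP[y xy Xy] uy]].
  case/setUP=> [|/(subsetP sPp)]; rewrite inE (eclass_eq xy).
    move=> /subsetP sx; split; apply/upperP; exists y => //;
      by have /setIP[] := sx y xy.
  by case/and3P=> _ ? ?; split; rewrite inE.
have [sx|nsx] := boolP (eclass x \subset X :&: Y).
  by exists x; rewrite ?eclass_refl // !inE sx.
have px : x \in pivots X Y by move: ux uy; rewrite !inE => -> ->; rewrite nsx.
have [z Pz] := P1 x px; have: z \in P :&: eclass x by rewrite Pz set11.
by case/setIP=> zP xz; exists z => //; rewrite inE zP orbT.
Qed.

Lemma RS_meet X Y :
  RS (praba_meet X Y) = (lower X :&: lower Y, upper X :&: upper Y).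
Proof.
apply: RS_meet_transversal; apply: transversalP.
exact/equivalence_partitionP/pivots_equiv.
Qed.

End SubsetOperations.

(* The set T of all rough sets RS X, for X a subset of U. *)
Record roughSet (I : approxSpace) := RoughSet {
  rs_val :> {set I} * {set I};
  rs_valP : rs_val \in [set RS X | X : {set I}]
}.

HB.instance Definition _ I := [isSub for @rs_val I].
HB.instance Definition _ I := [Finite of roughSet I by <:].

Fact rough_display : Order.disp_t. Proof. exact: (Order.Disp tt tt). Qed.

Section RoughSets.
Variable I : approxSpace.
Implicit Types (X Y : {set I}) (a b c : roughSet I).

Lemma RS_rough X : RS X \in [set RS Z | Z : {set I}].
Proof. exact: imset_f. Qed.

Definition RSet X : roughSet I := RoughSet (RS_rough X).

Definition rs_repr a : {set I} := odflt set0 [pick X | RS X == rs_val a].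

Lemma rs_reprK a : RSet (rs_repr a) = a.
Proof.
apply: val_inj; rewrite /= /rs_repr; case: pickP => [X /eqP //|].
by have /imsetP[X _ ->] := rs_valP a; move/(_ X); rewrite eqxx.
Qed.

End RoughSets.

(* Locked so that unification never unfolds the iterations and choices
   underneath; use [rs_joinE], [rs_meetE], [rs_join_RS] and [rs_meet_RS]. *)
HB.lock Definition rs_join (I : approxSpace) (a b : roughSet I) : roughSet I :=
  RSet (praba_join (rs_repr a) (rs_repr b)).
HB.lock Definition rs_meet (I : approxSpace) (a b : roughSet I) : roughSet I :=
  RSet (praba_meet (rs_repr a) (rs_repr b)).

Section RoughSetTheory.
Variable I : approxSpace.
Implicit Types (X Y : {set I}) (a b c : roughSet I).

Definition rs_le a b := (a.1 \subset b.1) && (a.2 \subset b.2).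

Lemma rs_joinE a b : rs_val (rs_join a b) = (a.1 :|: b.1, a.2 :|: b.2).
Proof.
by rewrite rs_join.unlock /= RS_join -{3 4}(rs_reprK a) -{3 4}(rs_reprK b).
Qed.

Lemma rs_meetE a b : rs_val (rs_meet a b) = (a.1 :&: b.1, a.2 :&: b.2).
Proof.
by rewrite rs_meet.unlock /= RS_meet -{3 4}(rs_reprK a) -{3 4}(rs_reprK b).
Qed.

(* The operations on T do not depend on the representatives [rs_repr]. *)
Lemma rs_join_RS X Y : rs_join (RSet X) (RSet Y) = RSet (praba_join X Y).
Proof. by apply: val_inj; rewrite -[LHS]/(rs_val _) rs_joinE /= RS_join. Qed.

Lemma rs_meet_RS X Y : rs_meet (RSet X) (RSet Y) = RSet (praba_meet X Y).
Proof. by apply: val_inj; rewrite -[LHS]/(rs_val _) rs_meetE /= RS_meet. Qed.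

Lemma rs_le_refl : reflexive rs_le.
Proof. by move=> a; rewrite /rs_le !subxx. Qed.

Lemma rs_le_anti : antisymmetric rs_le.
Proof.
move=> a b /andP[/andP[ab1 ab2] /andP[ba1 ba2]]; apply: val_inj => /=.
rewrite [LHS]surjective_pairing [RHS]surjective_pairing.
by congr (_, _); apply/eqP; rewrite eqEsubset ?ab1 ?ab2.
Qed.

Lemma rs_le_trans : transitive rs_le.
Proof.
move=> b a c /andP[ab1 ab2] /andP[bc1 bc2].
by rewrite /rs_le (subset_trans ab1) // (subset_trans ab2).
Qed.

Lemma lower0 : lower (set0 : {set I}) = set0.
Proof.
apply/setP=> x; rewrite !inE subset0; apply/negbTE/set0Pn.
by exists x; apply: eclass_refl.
Qed.

Lemma upper0 : upper (set0 : {set I}) = set0.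
Proof. by apply/setP=> x; rewrite !inE setI0 eqxx. Qed.

Lemma lowerT : lower [set: I] = setT.
Proof. by apply/setP=> x; rewrite !inE subsetT. Qed.

Lemma upperT : upper [set: I] = setT.
Proof.
apply/setP=> x; rewrite !inE setIT; apply/set0Pn.
by exists x; apply: eclass_refl.
Qed.

Lemma rs_eqP a b : a.1 = b.1 -> a.2 = b.2 -> a = b.
Proof.
move=> e1 e2; apply: val_inj => /=.
by rewrite [LHS]surjective_pairing e1 e2 -surjective_pairing.
Qed.

Lemma rs_join_lower a b : (rs_join a b).1 = a.1 :|: b.1.
Proof. by rewrite rs_joinE. Qed.
Lemma rs_join_upper a b : (rs_join a b).2 = a.2 :|: b.2.
Proof. by rewrite rs_joinE. Qed.
Lemma rs_meet_lower a b : (rs_meet a b).1 = a.1 :&: b.1.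
Proof. by rewrite rs_meetE. Qed.
Lemma rs_meet_upper a b : (rs_meet a b).2 = a.2 :&: b.2.
Proof. by rewrite rs_meetE. Qed.

Let rsE := (rs_join_lower, rs_join_upper, rs_meet_lower, rs_meet_upper).

Lemma rs_join_lub a b c : rs_le (rs_join a b) c = rs_le a c && rs_le b c.
Proof. by rewrite /rs_le !rsE !subUset andbACA. Qed.

Lemma rs_meet_glb a b c : rs_le c (rs_meet a b) = rs_le c a && rs_le c b.
Proof. by rewrite /rs_le !rsE !subsetI andbACA. Qed.

Lemma rs_joinA : associative (@rs_join I).
Proof. by move=> a b c; apply: rs_eqP; rewrite !rsE setUA. Qed.

Lemma rs_joinC : commutative (@rs_join I).
Proof. by move=> a b; apply: rs_eqP; rewrite !rsE setUC. Qed.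

Lemma rs_join0s : left_id (RSet set0) (@rs_join I).
Proof.
move=> a; apply: rs_eqP; rewrite !rsE.
  by rewrite [X in X :|: _]lower0 set0U.
by rewrite [X in X :|: _]upper0 set0U.
Qed.

Lemma rs_meetA : associative (@rs_meet I).
Proof. by move=> a b c; apply: rs_eqP; rewrite !rsE setIA. Qed.

Lemma rs_meetC : commutative (@rs_meet I).
Proof. by move=> a b; apply: rs_eqP; rewrite !rsE setIC. Qed.

Lemma rs_meetTs : left_id (RSet setT) (@rs_meet I).
Proof.
move=> a; apply: rs_eqP; rewrite !rsE.
  by rewrite [X in X :&: _]lowerT setTI.
by rewrite [X in X :&: _]upperT setTI.
Qed.

Lemma rs_meet_joinl : left_distributive (@rs_meet I) (@rs_join I).
Proof. by move=> a b c; apply: rs_eqP; rewrite !rsE setIUl. Qed.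

Lemma rs_meet0s : left_zero (RSet set0) (@rs_meet I).
Proof.
move=> a; apply: rs_eqP; rewrite !rsE.
  by rewrite [X in X :&: _]lower0 set0I [RHS]lower0.
by rewrite [X in X :&: _]upper0 set0I [RHS]upper0.
Qed.

Lemma rs_1neq0 : RSet [set: I] != RSet (set0 : {set I}).
Proof.
apply/eqP=> /(congr1 (fun a => #|a.1|)) /=; rewrite lower0 lowerT cards0 cardsT.
by apply/eqP; rewrite -lt0n universe_gt0.
Qed.

End RoughSetTheory.

HB.instance Definition _ I :=
  Order.Le_isPOrder.Build rough_display (roughSet I)
    (@rs_le_refl I) (@rs_le_anti I) (@rs_le_trans I).

(* The rough semiring of I: T with + and * being the joins and meets above. *)
HB.instance Definition _ I :=
  GRing.isNmodule.Build (roughSet I) (@rs_joinA I) (@rs_joinC I) (@rs_join0s I).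
HB.instance Definition _ I :=
  GRing.Nmodule_isComNzSemiRing.Build (roughSet I)
    (@rs_meetA I) (@rs_meetC I) (@rs_meetTs I) (@rs_meet_joinl I)
    (@rs_meet0s I) (@rs_1neq0 I).

Definition is_greatest d (T : porderType d) (P : T -> Prop) (m : T) : Prop :=
  P m /\ forall w, P w -> (w <= m)%O.

Definition rel_pseudocompl (I : approxSpace) (y z p : roughSet I) : Prop :=
  is_greatest (fun w : roughSet I => (y * w)%R <= z)%O p.

(* Main.v *)
(* T is a finite lattice in which the semiring multiplication (the meet)
   distributes over the addition (the join).  Hence the sum of all [w] with
   [y * w <= z] still satisfies this inequality, and it dominates all of them. *)
Require Import Defs.
From mathcomp Require Import all_boot all_order all_algebra.

Import Order.Theory GRing.Theory.
Local Open Scope ring_scope.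

Lemma rs_addr_le (I : approxSpace) (a b c : roughSet I) :
  (a + b <= c)%O = (a <= c)%O && (b <= c)%O.
Proof. exact: rs_join_lub. Qed.

Lemma rs_le0r (I : approxSpace) (a : roughSet I) : ((0 : roughSet I) <= a)%O.
(* Since [a] equals [0 + a], reflexivity at [a] bounds both summands by [a]. *)
Proof. by have := lexx a; rewrite -{1}[a]add0r rs_addr_le => /andP[]. Qed.

(** Carries the least upper bound property of [+] over to finite sums; the base case holds because
    [0] is the least element. *)
Lemma rs_sumr_le (I : approxSpace) (J : finType) (P : pred J)
    (F : J -> roughSet I) (c : roughSet I) :
  (\sum_(j | P j) F j <= c)%O = [forall (j | P j), F j <= c]%O.
Proof.
apply/idP/forall_inP => [le_c j Pj|le_c].
  by move: le_c; rewrite (bigD1 j) //= rs_addr_le => /andP[].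
elim/big_ind: _ => [|a b ac bc|//]; first exact: rs_le0r.
by rewrite rs_addr_le ac.
Qed.

Lemma rel_pseudocompl_sum (I : approxSpace) (y z : roughSet I) :
  rel_pseudocompl y z (\sum_(w | (y * w <= z)%O) w).
Proof.
(* Once [y] is distributed, the bound on each term is the condition selecting its index. *)
split; first by rewrite mulr_sumr rs_sumr_le; apply/forall_inP.
(* Reflexivity at the sum, read termwise, says that it dominates every selected [w]. *)
by have := lexx (\sum_(w | (y * w <= z)%O) w); rewrite rs_sumr_le => /forall_inP.
Qed.

Lemma is_greatest_unique d (T : porderType d) (P : T -> Prop) (m n : T) :
  is_greatest P m -> is_greatest P n -> m = n.
Proof.
by move=> [Pm max_m] [Pn max_n]; apply: le_anti; rewrite max_n ?max_m.
Qed.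

Local Close Scope ring_scope.

Theorem theorem4 (I : approxSpace) (y z : roughSet I) :
  exists! p : roughSet I, rel_pseudocompl y z p.
Proof.
exists (\sum_(w | (y * w <= z)%O) w)%R; split; first exact: rel_pseudocompl_sum.
by move=> p; apply/is_greatest_unique/rel_pseudocompl_sum.
Qed.
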